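(* Let $A$ be a finite alphabet, let $\phi\colon A^*\to A^*$ be a non-erasing morphism and let $s\in A$ be such that $\phi$ is prolongable on $s$, and assume that every symbol of $A$ occurs in $\phi^\infty(s)$. Let $I$, $F$, $G$, $L$, $R$ be as defined in the context. Then $\phi^\infty(s)$ is almost periodic if and only if (1) the subgraph of $G$ induced on $I$ is strongly connected, and (2) in each of the graphs $L$ and $R$, every edge lying on a cycle is labeled by the empty word $\Lambda$.
   Context: A morphism $\phi\colon A^*\to A^*$ satisfies $\phi(uv)=\phi(u)\phi(v)$; it is non-erasing if $|\phi(a)|\ge 1$ for every $a\in A$. $\phi$ is prolongable on $s$ if $\phi(s)=su$ with $\phi^n(u)\ne\Lambda$ for all $n$; then $\phi^\infty(s)=\lim_n\phi^n(s)$ is an infinite sequence. A sequence $x$ is almost periodic if for every factor $u$ of $x$ there is $l$ such that every factor of $x$ of length $l$ contains an occurrence of $u$. Let $I$ be the set of $b\in A$ with $|\phi^m(b)|\to\infty$ as $m\to\infty$, and $F=A\setminus I$ (the $b$ with $|\phi^m(b)|$ bounded). $G$ is the directed graph with vertex set $A$ having an edge from $b$ to $c$ iff $c$ occurs in $\phi(b)$. The ''graph of left tails'' $L$ has vertex set $I$; from each $b\in I$ exactly one edge leaves: write $\phi(b)=ucv$ with $c\in I$ and $u\in F^*$ the maximal prefix of $\phi(b)$ consisting only of symbols from $F$; the edge goes from $b$ to $c$ and is labeled by the word $u$. The ''graph of right tails'' $R$ is defined analogously using the decomposition $\phi(b)=vcu$ with $c\in I$ and $u\in F^*$ the maximal suffix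 of $\phi(b)$ consisting only of symbols of $F$; the edge goes from $b$ to $c$ with label $u$. *)

(* Defs.v *)
From mathcomp Require Import all_boot.
From mathcomp Require Import boolp.

Set Implicit Arguments.
Unset Strict Implicit.
Unset Printing Implicit Defensive.

(* Words over A are [seq A]; a morphism of A^* is a function phi on words with
   {morph phi : u v / u ++ v}, and phi^n is [iter n phi]. *)

Definition nonerasing (A : eqType) (phi : seq A -> seq A) : Prop :=
  forall a : A, 1 <= size (phi [:: a]).

Definition prolongable (A : eqType) (phi : seq A -> seq A) (s : A) : Prop :=
  exists u : seq A,
    phi [:: s] = s :: u /\ (forall n : nat, iter n phi u <> [::]).

Definition word_lim (A : eqType) (w : nat -> seq A) (x : nat -> A) : Prop :=
  forall n : nat, exists M : nat,
    forall m : nat, M <= m -> prefix (mkseq x n) (w m).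

(* The limit of phi^n(s); when phi is a morphism prolongable on s, phi^i(s) is
   a prefix of it of length > i. See phi_infty_lim and word_lim_unique. *)
Definition phi_infty (A : eqType) (phi : seq A -> seq A) (s : A) : nat -> A :=
  fun i => nth s (iter i phi [:: s]) i.

Lemma word_lim_unique (A : eqType) (w : nat -> seq A) (x y : nat -> A) :
  word_lim w x -> word_lim w y -> x =1 y.
Proof.
move=> hx hy i.
have [M hM] := hx i.+1; have [N hN] := hy i.+1.
have /prefixP[u Eu] := hM _ (leq_maxl M N).
have /prefixP[v Ev] := hN _ (leq_maxr M N).
have : nth (x i) (mkseq x i.+1 ++ u) i = nth (x i) (mkseq y i.+1 ++ v) i.
  by rewrite -Eu -Ev.
by rewrite !nth_cat !size_mkseq ltnSn !nth_mkseq.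
Qed.

Lemma phi_infty_lim (A : eqType) (phi : seq A -> seq A) (s : A) :
  {morph phi : u v / u ++ v} -> prolongable phi s ->
  word_lim (fun n => iter n phi [:: s]) (phi_infty phi s).
Proof.
move=> phiM [u [phis uN0]].
have iterM n : {morph iter n phi : v w / v ++ w}.
  by elim: n => [//|n IH] v w /=; rewrite IH phiM.
have iterSs n : iter n.+1 phi [:: s] = iter n phi [:: s] ++ iter n phi u.
  by rewrite iterSr phis -cat1s iterM.
have szs n : n < size (iter n phi [:: s]).
  elim: n => [//|n IH]; rewrite iterSs size_cat.
  have : 0 < size (iter n phi u) by rewrite lt0n size_eq0; apply/eqP/uN0.
  by move=> ?; rewrite -addn1; apply: leq_add.
have pre m n : m <= n -> prefix (iter m phi [:: s]) (iter n phi [:: s]).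
  move/subnK<-; elim: (n - m) => [|k IH]; first exact: prefix_refl.
  by rewrite addSn iterSs; apply: (prefix_trans IH); apply: prefix_prefix.
move=> n; exists n => m le_nm.
have -> : mkseq (phi_infty phi s) n = take n (iter m phi [:: s]).
  have sz : n <= size (iter m phi [:: s]) by rewrite (leq_trans le_nm) // ltnW.
  apply: (@eq_from_nth _ s); first by rewrite size_mkseq size_takel.
  move=> i; rewrite size_mkseq => lt_in.
  rewrite nth_mkseq // nth_take // /phi_infty.
  have /prefixP[v ->] := pre i m (ltnW (leq_trans lt_in le_nm)).
  by rewrite nth_cat szs.
exact: prefix_take.
Qed.

Definition factor (A : eqType) (x : nat -> A) (u : seq A) : Prop :=
  exists i : nat, u = mkseq (fun k => x (i + k)) (size u).

Definition almost_periodic (A : eqType) (x : nat -> A) : Prop :=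
  forall u : seq A, factor x u ->
    exists l : nat, forall v : seq A, factor x v -> size v = l -> infix u v.

(* The sets I and F; the limit condition is made boolean classically. *)
Definition Iset (A : eqType) (phi : seq A -> seq A) : pred A :=
  fun b => `[< forall N : nat, exists M : nat,
                 forall m : nat, M <= m -> N <= size (iter m phi [:: b]) >].

Definition Fset (A : eqType) (phi : seq A -> seq A) : pred A :=
  [predC Iset phi].

Definition Ggraph (A : eqType) (phi : seq A -> seq A) : rel A :=
  fun b c => c \in phi [:: b].

Definition induced (A : eqType) (V : pred A) (E : rel A) : rel A :=
  fun b c => [&& V b, V c & E b c].

Definition strongly_connected_on (A : finType) (V : pred A) (E : rel A) : Prop :=
  forall b c : A, V b -> V c -> connect (induced V E) b c.

(* A graph with edges labeled by words: (b, u, c) is an edge from b to c with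
   label u. *)
Definition edge (A : eqType) : Type := (A * seq A * A)%type.
Definition src (A : eqType) (e : edge A) : A := e.1.1.
Definition label (A : eqType) (e : edge A) : seq A := e.1.2.
Definition tgt (A : eqType) (e : edge A) : A := e.2.

(* As c is in I, the word u over F is automatically the maximal prefix (resp.
   suffix) of phi(b) over F. *)
Definition Lgraph (A : eqType) (phi : seq A -> seq A) : pred (edge A) :=
  fun e => [&& Iset phi (src e), Iset phi (tgt e), all (Fset phi) (label e)
             & prefix (rcons (label e) (tgt e)) (phi [:: src e])].

Definition Rgraph (A : eqType) (phi : seq A -> seq A) : pred (edge A) :=
  fun e => [&& Iset phi (src e), Iset phi (tgt e), all (Fset phi) (label e)
             & suffix (tgt e :: label e) (phi [:: src e])].

(* A directed cycle, as the cyclic list of its edges, without repeated vertex;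
   loops are cycles of length 1. *)
Definition graph_cycle (A : eqType) (E : pred (edge A)) (p : seq (edge A)) : bool :=
  [&& all E p, cycle (fun e f => tgt e == src f) p & uniq (map (@src A) p)].

Definition cycle_labels_empty (A : eqType) (E : pred (edge A)) : Prop :=
  forall (p : seq (A * seq A * A)) (e : edge A),
    graph_cycle E p -> e \in p -> label e = [::].

(* Main.v *)
Require Import Defs.
From mathcomp Require Import all_boot.
From mathcomp Require Import boolp.

(* For a in I let p_n(a) be the length of the maximal prefix over F of phi^n(a).
   An edge (a, u, c) of L gives p_(n+1)(a) = |phi^n(u)| + p_n(c), and the images
   of words over F stay bounded, so all the p_n(a) are bounded iff the cycles of
   L have empty labels; R is handled by reversing phi. Both conditions together
   say that the factors over F of the words phi^n(a) are bounded, because such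
   a factor of phi^n(phi(a)) lies within the image of a letter or straddles
   boundaries between such images. When they are bounded and I is strongly
   connected, s appears in the image by a fixed power of phi of every long
   enough factor, hence recurs with bounded gaps, and so does every prefix
   phi^n(s). Conversely, almost periodicity forces every long enough factor to
   contain s, a letter of I, which bounds the factors over F, and forces the
   growing words phi^n(b), for b in I, to contain every letter. *)

Set Implicit Arguments.
Unset Strict Implicit.
Unset Printing Implicit Defensive.

(** * Factors of concatenated words *)

Lemma cat_eq_cat (T : eqType) (w1 w2 p q : seq T) :
  w1 ++ w2 = p ++ q ->
  (exists t, w1 = p ++ t /\ q = t ++ w2) \/
  (exists t, p = w1 ++ t /\ w2 = t ++ q).
Proof.
elim: w1 p => [|a w1 IH] [|b p] //=.
- by move=> <-; left; exists [::].
- by move=> ->; right; exists (b :: p).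
- by move=> <-; left; exists (a :: w1).
case=> -> /IH[[t [-> ->]]|[t [-> ->]]]; first by left; exists t.
by right; exists t.
Qed.

Lemma infix_cat (T : eqType) (v w1 w2 : seq T) :
  infix v (w1 ++ w2) ->
  [\/ infix v w1, infix v w2 |
      exists v1 v2, [/\ v = v1 ++ v2, suffix v1 w1 & prefix v2 w2]].
Proof.
move=> /infixP[p [q /cat_eq_cat[[t [-> /cat_eq_cat[]]]|[t [_ ->]]]]].
- move=> [t' [-> ->]]; constructor 3; exists t, t'.
  by rewrite suffix_suffix prefix_prefix.
- by move=> [t' [-> _]]; constructor 1; apply: infix_infix.
- by constructor 2; apply: infix_infix.
Qed.

Lemma find_cat_le (T : Type) (p : pred T) (u v : seq T) :
  find p (u ++ v) <= size u + find p v.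
Proof.
rewrite find_cat; case: ifP => // _.
by rewrite (leq_trans (find_size _ _)) // leq_addr.
Qed.

Lemma prefix_leq_find (T : eqType) (p : pred T) (v w : seq T) :
  prefix v w -> ~~ has p v -> size v <= find p w.
Proof. by move=> /prefixP[t ->] /negPf hv; rewrite find_cat hv leq_addr. Qed.

Lemma prefix_take_find (T : eqType) (p : pred T) (x : T) (w : seq T) :
  has p w -> prefix (rcons (take (find p w) w) (nth x w (find p w))) w.
Proof.
rewrite has_find => lt_w; rewrite -take_nth //; exact: prefix_take.
Qed.

(** * Iterates of a non-erasing morphism *)

Section Morphism.
Variables (A : finType) (phi : seq A -> seq A).
Hypothesis phiM : {morph phi : u v / u ++ v}.
Hypothesis phi_ne : nonerasing phi.

Local Notation I := (Iset phi).
Local Notation F := (Fset phi).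

Lemma iterM n : {morph iter n phi : u v / u ++ v}.
Proof. by elim: n => [//|n IH] u v /=; rewrite IH phiM. Qed.

Lemma phi_nil : phi [::] = [::].
Proof.
apply: size0nil; have := congr1 size (phiM [::] [::]).
by rewrite size_cat /= => /eqP; rewrite -[X in X == _]addn0 eqn_add2l => /eqP.
Qed.

Lemma iter_nil n : iter n phi [::] = [::].
Proof. by elim: n => [//|n /= ->]; apply: phi_nil. Qed.

Lemma iter_cons n a w : iter n phi (a :: w) = iter n phi [:: a] ++ iter n phi w.
Proof. by rewrite -cat1s iterM. Qed.

Lemma size_phi w : size w <= size (phi w).
Proof.
elim: w => [//|a w IH]; rewrite -cat1s phiM !size_cat leq_add //.
Qed.

Lemma size_iter m n w : m <= n -> size (iter m phi w) <= size (iter n phi w).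
Proof.
move/subnK<-; elim: (n - m) => [//|k IH].
by rewrite addSn /= (leq_trans IH) // size_phi.
Qed.

Lemma mem_iter_cat c w1 w2 n :
  c \in iter n phi (w1 ++ w2) =
  (c \in iter n phi w1) || (c \in iter n phi w2).
Proof. by rewrite iterM mem_cat. Qed.

Lemma mem_iterP c n w :
  reflect (exists2 d, d \in w & c \in iter n phi [:: d]) (c \in iter n phi w).
Proof.
apply: (iffP idP) => [|[d]].
  elim: w => [|a w IH]; first by rewrite iter_nil.
  rewrite iter_cons mem_cat => /orP[ca|/IH[d dw cd]].
    by exists a; rewrite ?mem_head.
  by exists d => //; rewrite inE dw orbT.
by case/splitPr => w1 w2 cd; rewrite mem_iter_cat iter_cons mem_cat cd orbT.
Qed.

Lemma infix_iter n v w : infix v w -> infix (iter n phi v) (iter n phi w).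
Proof. by move=> /infixP[p [q ->]]; rewrite !iterM infix_infix. Qed.

Lemma infix_iter_letter n a w : a \in w -> infix (iter n phi [:: a]) (iter n phi w).
Proof. by case/splitPr => w1 w2; apply: infix_iter; rewrite -cat1s infix_infix. Qed.

(** Lengths of iterates never decrease, so reaching each [N] once amounts to tending to infinity. *)
Lemma IsetP b :
  reflect (forall N, exists n, N <= size (iter n phi [:: b])) (I b).
Proof.
apply: (iffP idP) => [/asboolW h N|h].
  by have [M hM] := h N; exists M; apply: hM.
apply/asboolP => N; have [n hn] := h N; exists n => m /size_iter le_nm.
exact: leq_trans hn _.
Qed.

Lemma all_Fset w : all F w = ~~ has I w.
Proof. by rewrite -all_predC. Qed.

Lemma Fset_bound :
  exists C, forall w n, all F w -> size (iter n phi w) <= C * size w.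
Proof.
have /fin_all_exists[f hf] : forall a : A, exists B, ~~ I a ->
    forall n, size (iter n phi [:: a]) <= B.
  move=> a; have [ia|/IsetP/existsNP[N hN]] := boolP (I a); first by exists 0.
  exists N => _ n; apply: contra_notT hN; rewrite -ltnNge => /ltnW ?.
  by exists n.
exists (\max_a f a) => w n; elim: w => [|a w IH]; first by rewrite iter_nil.
move=> /= /andP[fa fw]; rewrite iter_cons size_cat mulnS leq_add ?IH //.
by rewrite (leq_trans (hf a fa n)) // (leq_bigmax a).
Qed.

(** If phi^n(a) were a word over F, [Fset_bound] would bound all iterates of [a]. Conversely,
    phi^m(d) is a factor of phi^(m+n)(a) for each letter [d] of phi^n(a). *)
Lemma Iset_has_iter n a : I a = has I (iter n phi [:: a]).
Proof.
apply/idP/idP => [/IsetP ia|/hasP[d da /IsetP id]].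
  rewrite -[has _ _]negbK -all_Fset; apply/negP => fa.
  have [C hC] := Fset_bound.
  have [m] := ia (C * size (iter n phi [:: a])).+1.
  rewrite ltnNge => /negP; apply; apply: leq_trans (hC _ m fa).
  by rewrite -iterD size_iter // leq_addr.
apply/IsetP => N; have [m hm] := id N; exists (m + n).
by rewrite iterD (leq_trans hm) // size_infix // infix_iter_letter.
Qed.

(** * Left tails and the cycles of L *)

Lemma find_Iset_edge n e : Lgraph phi e ->
  find I (iter n.+1 phi [:: src e]) =
  size (iter n phi (label e)) + find I (iter n phi [:: tgt e]).
Proof.
move=> /and4P[_ it fl /prefixP[t ht]].
rewrite iterSr ht cat_rcons iterM iter_cons !find_cat -Iset_has_iter it.
suff -> : has I (iter n phi (label e)) = false by [].
apply: contraTF fl => /hasP[d dl id]; rewrite all_Fset negbK.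
have [b bl db] := mem_iterP _ _ _ dl; apply/hasP; exists b => //.
by rewrite (Iset_has_iter n); apply/hasP; exists d.
Qed.

(** L as a functional graph: for [a] in I the word phi(a) has a letter of I, so the default of [nth]
    in [left_next] is not reached. *)
Definition left_label a := take (find I (phi [:: a])) (phi [:: a]).
Definition left_next a := nth a (phi [:: a]) (find I (phi [:: a])).
Definition left_edge a : edge A := (a, left_label a, left_next a).

Lemma Lgraph_left_edge a : I a -> Lgraph phi (left_edge a).
Proof.
move=> ia; have ha : has I (phi [:: a]) by rewrite -(Iset_has_iter 1).
apply/and4P; split=> //=; first by rewrite nth_find.
  by rewrite all_Fset has_take_leq ?ltnn // find_size.
exact: prefix_take_find.
Qed.

(* Only labels off the cycles contribute to the prefix over F of phi^n(a), and
   a walk in a functional graph meets each such vertex at most once. *)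
Lemma cycle_labels_prefix_bound : cycle_labels_empty (Lgraph phi) ->
  exists P, forall a n, I a -> find I (iter n phi [:: a]) <= P.
Proof.
move=> cyc; have [C hC] := Fset_bound.
pose M := \max_a size (phi [:: a]).
(* Each vertex of [reach a] contributes at most [C * M], its label having length at most [M]. *)
pose reach a := [set b | fconnect left_next a b & left_label b != [::]].
have Inext a : I a -> I (left_next a).
  by move=> /Lgraph_left_edge/and4P[].
have off_cycle a : I a -> left_label a != [::] ->
    ~~ fconnect left_next (left_next a) a.
  (* If [a] is reachable from its successor, its orbit is a cycle of L, so its label is empty. *)
  move=> ia la; apply/negP => /(orbitPcycle 2 0) cyca.
  case/eqP: la; apply: (cyc (map left_edge (orbit left_next a)) (left_edge a)).
    apply/and3P; split.
    - apply/allP => _ /mapP[b bo ->]; apply: Lgraph_left_edge.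
      move: bo; rewrite -fconnect_orbit => /iter_findex <-.
      by elim: (findex _ _ _) => [//|k /Inext].
    - by rewrite cycle_map; apply: sub_cycle cyca.
    - by rewrite -map_comp map_id orbit_uniq.
  by rewrite map_f // -fconnect_orbit connect0.
exists (C * M * #|A|) => a n ia.
suff h : find I (iter n phi [:: a]) <= C * M * #|reach a|.
  by rewrite (leq_trans h) // leq_mul2l max_card orbT.
elim: n a ia => [|n IH] a ia; first by rewrite /= ia.
have ea := Lgraph_left_edge ia.
rewrite (find_Iset_edge n ea) /=.
have sub : reach (left_next a) \subset reach a.
  apply/subsetP => b; rewrite !inE => /andP[cb ->]; rewrite andbT.
  by apply: connect_trans cb; apply: fconnect1.
have [la|la] := eqVneq (left_label a) [::].
  rewrite /label /= la iter_nil add0n (leq_trans (IH _ (Inext _ ia))) //.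
  by rewrite leq_mul2l subset_leq_card ?orbT.
(* Being off the cycles, [a] is lost from [reach] on passing to its successor; this drop pays for
   its label. *)
have prop : reach (left_next a) \proper reach a.
  rewrite properE sub; apply/subsetPn; exists a.
    by rewrite inE la connect0.
  by rewrite inE negb_and (off_cycle _ ia la).
apply: leq_trans (_ : C * M * #|reach (left_next a)|.+1 <= _); last first.
  by rewrite leq_mul2l proper_card ?orbT.
rewrite mulnS leq_add ?IH ?Inext //.
have /and4P[_ _ fl _] := ea.
rewrite (leq_trans (hC _ n fl)) // leq_mul2l; apply/orP; right.
rewrite (leq_trans _ (leq_bigmax a)) //=.
by rewrite size_take_min geq_minr.
Qed.

(** Follows from [find_Iset_edge] along the walk, keeping only the first label; images of words
    never shrink. *)
Lemma walk_find n e p : all (Lgraph phi) (e :: p) ->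
  path (fun e f => tgt e == src f) e p ->
  size (label e) + find I (iter n phi [:: tgt (last e p)]) <=
  find I (iter (n + size p).+1 phi [:: src e]).
Proof.
elim: p e => [|f p IH] e /= /andP[le lp].
  rewrite (find_Iset_edge _ le) addn0 leq_add2r => _.
  exact: (size_iter _ (leq0n n)).
case/andP=> /eqP ef /(IH f lp) h.
rewrite (find_Iset_edge _ le) leq_add //; first exact: (size_iter _ (leq0n _)).
by rewrite ef addnS (leq_trans _ h) // leq_addl.
Qed.

Lemma prefix_bound_cycle_labels P :
  (forall a n, I a -> find I (iter n phi [:: a]) <= P) ->
  cycle_labels_empty (Lgraph phi).
Proof.
move=> hP p e /and3P[Lp cp _] ep.
have [i p' rp] := rot_to ep.
move: Lp cp; rewrite -(rot_cycle i) -(eq_all_r (mem_rot i p)) rp {ep rp p} => Lp.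
rewrite /= rcons_path => /andP[pp /eqP lp].
apply/eqP/negPn/negP; rewrite -size_eq0 -lt0n => l0.
(* Each turn around the cycle, rotated to start at [e], adds at least one letter because the label
   of [e] is nonempty. *)
have grow j : j <= find I (iter (j * (size p').+1) phi [:: src e]).
  elim: j => [//|j IH]; rewrite mulSn addnC addnS.
  apply: leq_trans (walk_find _ Lp pp); rewrite lp -add1n.
  exact: leq_add.
have ie : I (src e) by case/andP: Lp => /and4P[].
by have := leq_trans (grow P.+1) (hP _ _ ie); rewrite ltnn.
Qed.

(** * Factors over F *)

Definition run_bound B w := forall v, infix v w -> all F v -> size v <= B.

Lemma run_bound_iter P :
  (forall a n, I a -> find I (iter n phi [:: a]) <= P) ->
  (forall a n, I a -> find I (rev (iter n phi [:: a])) <= P) ->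
  exists B, forall a n, run_bound B (iter n phi [:: a]).
Proof.
move=> hpre hsuf; have [C hC] := Fset_bound.
pose M := \max_a size (phi [:: a]).
(* Each letter of F before the first letter of I adds at most [C], and that letter of I at most
   [P]. *)
have pre w n : find I (iter n phi w) <= C * size w + P.
  elim: w => [|a w IH]; first by rewrite iter_nil.
  rewrite iter_cons mulnS; have [ia|fa] := boolP (I a).
    rewrite find_cat -Iset_has_iter ia (leq_trans (hpre _ _ ia)) //.
    exact: leq_addl.
  rewrite (leq_trans (find_cat_le _ _ _)) // -addnA leq_add //.
  by rewrite -[C]muln1; apply: (hC [:: a]); rewrite all_Fset /= orbF.
have suf a n : find I (rev (iter n phi [:: a])) <= C + P.
  have [ia|fa] := boolP (I a).
    by rewrite (leq_trans (hsuf _ _ ia)) // leq_addl.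
  rewrite (leq_trans (find_size _ _)) // size_rev (leq_trans _ (leq_addr _ _)) //.
  by rewrite -[C]muln1; apply: (hC [:: a]); rewrite all_Fset /= orbF.
(* A straddling factor is a suffix over F of one image, at most [C + P], then a prefix over F of the
   remaining images, at most [C * M + P]. The successor covers the single letter at [n = 0]. *)
pose B := (C + P + (C * M + P)).+1.
exists B => a n; elim: n a => [|n IH] a.
  by move=> v /size_infix /= v1 _; rewrite (leq_trans v1).
have word w : size w <= M -> run_bound B (iter n phi w).
  elim: w => [_|b w IHw].
    by rewrite iter_nil => v; rewrite infixs0 => /eqP->.
  move=> /= szw v; rewrite iter_cons => /infix_cat[]; first exact: IH.
    by apply: IHw; apply: ltnW.
  move=> [v1 [v2 [-> s1 s2]]]; rewrite all_cat !all_Fset => /andP[f1 f2].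
  rewrite size_cat ltnW // ltnS leq_add //.
    apply: leq_trans (suf b n); rewrite -(size_rev v1) prefix_leq_find ?has_rev //.
  rewrite (leq_trans (prefix_leq_find s2 f2)) // (leq_trans (pre _ _)) //.
  by rewrite leq_add2r leq_mul2l ltnW ?orbT.
by rewrite iterSr; apply: word; apply: (leq_bigmax a).
Qed.

(** * Reachability in G *)

Lemma connect_mem_iter n b c : I c -> c \in iter n phi [:: b] ->
  connect (induced I (Ggraph phi)) b c.
Proof.
elim: n c => [|n IH] c ic; first by rewrite inE => /eqP->.
rewrite iterS => /(mem_iterP _ 1)[d db cd].
(* A letter whose image meets I is in I, so a path traced back from [c] never leaves I. *)
have id : I d by rewrite (Iset_has_iter 1); apply/hasP; exists c.
apply: connect_trans (IH d id db) _; apply: connect1.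
by rewrite /induced id ic.
Qed.

Lemma connect_iter_mem b c : connect (induced I (Ggraph phi)) b c ->
  exists n, c \in iter n phi [:: b].
Proof.
case/connectP => p; elim: p b => [|d p IH] b /=.
  by move=> _ ->; exists 0; apply: mem_head.
case/andP=> /and3P[_ _ bd] /IH/[apply] [[n cd]]; exists n.+1.
by rewrite iterSr; apply/mem_iterP; exists d.
Qed.

(** * Desubstitution *)

Lemma iter_cat_drop n D w p r :
  (forall a, size (iter n phi [:: a]) <= D) -> iter n phi w = p ++ r ->
  exists w1 w2 t, [/\ w = w1 ++ w2, r = t ++ iter n phi w2 & size t <= D].
Proof.
move=> hD; elim: w p => [|a w IH] p.
  rewrite iter_nil; case: p r => [|//] [|//] _.
  by exists [::], [::], [::]; rewrite iter_nil.
rewrite iter_cons => /cat_eq_cat[[t [ha ->]]|[t [_ /IH[w1 [w2 [t' [-> -> st]]]]]]].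
  exists [:: a], w, t; split=> //.
  by rewrite (leq_trans _ (hD a)) // ha size_cat leq_addl.
by exists (a :: w1), w2, t'.
Qed.

(** [v] starts with at most [D] letters of a partly covered image; the more than [k * D] letters
    left cover [k] whole images. *)
Lemma infix_iter_desubst n D k v w :
  (forall a, size (iter n phi [:: a]) <= D) ->
  infix v (iter n phi w) -> k.+1 * D < size v ->
  exists w', [/\ infix w' w, size w' = k & infix (iter n phi w') v].
Proof.
move=> hD /infixP[p [q /(iter_cat_drop hD)[w1 [w2 [t [-> e st]]]]]].
rewrite mulSn => lt_v.
have hsz u : size (iter n phi u) <= size u * D.
  elim: u => [|a u IH]; first by rewrite iter_nil.
  by rewrite iter_cons size_cat mulSn leq_add.
move/cat_eq_cat: e => [[v' [ev e]]|[t' [et _]]]; last first.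
  move: st; rewrite et size_cat => /(leq_trans (leq_addr _ _)).
  by move=> /(leq_trans lt_v); rewrite ltnNge leq_addr.
have szv' : k * D < size v'.
  rewrite -(ltn_add2l D) (leq_trans lt_v) // ev size_cat leq_add2r //.
have kw2 : k <= size w2.
  rewrite leqNgt; apply/negP => lt_k; move: szv'; rewrite ltnNge => /negP; apply.
  apply: leq_trans (_ : size w2 * D <= _); last by rewrite leq_mul2r ltnW ?orbT.
  by rewrite (leq_trans _ (hsz w2)) // e size_cat leq_addr.
exists (take k w2); split; last 2 first.
- exact: size_takel.
- move: e; rewrite -{1}(cat_take_drop k w2) iterM => /cat_eq_cat[[t' [e _]]|[t' [e _]]].
    rewrite ev; have := hsz (take k w2); rewrite size_takel // => hk.
    have := leq_ltn_trans hk szv'; rewrite e size_cat ltnNge => /negP[].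
    exact: leq_addr.
  by rewrite ev e infix_infix.
- apply: infix_catl; exact/prefixW/prefix_take.
Qed.

End Morphism.

(** * Exchange of L and R by reversal *)

Definition rev_morph (A : eqType) (phi : seq A -> seq A) (w : seq A) : seq A :=
  rev (phi (rev w)).

Section Reversal.
Variables (A : finType) (phi : seq A -> seq A).

Lemma rev_morphM : {morph phi : u v / u ++ v} ->
  {morph rev_morph phi : u v / u ++ v}.
Proof. by move=> phiM u v; rewrite /rev_morph rev_cat phiM rev_cat. Qed.

Lemma rev_morph_nonerasing : nonerasing phi -> nonerasing (rev_morph phi).
Proof. by move=> ne a; rewrite size_rev; apply: ne. Qed.

Lemma iter_rev_morph n w : iter n (rev_morph phi) w = rev (iter n phi (rev w)).
Proof.
by elim: n => [|n IH] /=; rewrite ?revK // IH /rev_morph revK.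
Qed.

Lemma Iset_rev_morph : Iset (rev_morph phi) = Iset phi.
Proof.
apply/funext => b; rewrite /Iset; congr asbool; apply/propext.
by split=> h N; have [M hM] := h N; exists M => m /hM;
  rewrite iter_rev_morph size_rev.
Qed.

Definition rev_label (e : edge A) : edge A := (src e, rev (label e), tgt e).

Lemma rev_labelK : involutive rev_label.
Proof. by case=> [[b u] c]; rewrite /rev_label /= /label /= revK. Qed.

Lemma Lgraph_rev_morph e : Lgraph (rev_morph phi) (rev_label e) = Rgraph phi e.
Proof.
rewrite /Lgraph /Rgraph /Fset Iset_rev_morph /= !all_predC has_rev.
by rewrite /rev_morph -rev_cons prefix_rev.
Qed.

Lemma graph_cycle_rev_label (p : seq (edge A)) :
  graph_cycle (Lgraph (rev_morph phi)) (map rev_label p) =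
  graph_cycle (Rgraph phi) p.
Proof.
rewrite /graph_cycle all_map cycle_map -map_comp.
by rewrite (eq_all (a2 := Rgraph phi) Lgraph_rev_morph).
Qed.

Lemma cycle_labels_rev_morph :
  cycle_labels_empty (Rgraph phi) <-> cycle_labels_empty (Lgraph (rev_morph phi)).
Proof.
split=> h p e.
  rewrite -{1}(mapK rev_labelK p) graph_cycle_rev_label => cp ep.
  have := h _ (rev_label e) cp (map_f _ ep).
  by move/(congr1 rev); rewrite revK.
rewrite -graph_cycle_rev_label => cp ep.
by have := h _ _ cp (map_f rev_label ep); move/(congr1 rev); rewrite revK.
Qed.

End Reversal.

(** * Factors of the limit sequence *)

Section Limit.
Variables (A : finType) (phi : seq A -> seq A) (s : A).
Hypothesis phiM : {morph phi : u v / u ++ v}.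
Hypothesis phi_ne : nonerasing phi.
Hypothesis phi_pr : prolongable phi s.

Local Notation x := (phi_infty phi s).

Lemma prefix_iter_start m n : m <= n ->
  prefix (iter m phi [:: s]) (iter n phi [:: s]).
Proof.
have [u [phis _]] := phi_pr.
move/subnK<-; elim: (n - m) => [|k IH]; first exact: prefix_refl.
rewrite addSn iterSr phis (iter_cons phiM _ s u).
by apply: (prefix_trans IH); apply: prefix_prefix.
Qed.

Lemma start_mem_iter n : s \in iter n phi [:: s].
Proof. by apply: (mem_infix (prefixW (prefix_iter_start (leq0n n)))); apply: mem_head. Qed.

Lemma size_iter_start n : n < size (iter n phi [:: s]).
Proof.
have [u [phis uN0]] := phi_pr.
elim: n => [//|n IH]; rewrite iterSr phis (iter_cons phiM _ s u) size_cat -addn1 leq_add //.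
by rewrite lt0n size_eq0; apply/eqP/uN0.
Qed.

Lemma Iset_start : Iset phi s.
Proof. by apply/IsetP => // N; exists N; apply/ltnW/size_iter_start. Qed.

Lemma iter_start_mkseq n :
  iter n phi [:: s] = mkseq x (size (iter n phi [:: s])).
Proof.
(* Both words are prefixes of a common iterate and have the same length. *)
have [M /(_ _ (leq_maxl M n))] := phi_infty_lim phiM phi_pr (size (iter n phi [:: s])).
have := prefix_iter_start (leq_maxr M n).
by rewrite !prefixE size_mkseq => /eqP{3}<- /eqP.
Qed.

Lemma factorP v : factor x v <-> exists n, infix v (iter n phi [:: s]).
Proof.
split=> [[i ->]|[n /infixP[p [q e]]]].
  (* phi^(i+k)(s) is longer than [i + k], so it covers the positions of [v]. *)
  set k := size v; exists (i + k).
  have le_ik := ltnW (size_iter_start (i + k)).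
  rewrite iter_start_mkseq /mkseq -(subnKC le_ik) iotaD map_cat.
  apply: infix_catr; rewrite iotaD map_cat; apply: infix_catl.
  by rewrite add0n -[in iota i k](addn0 i) iotaDl -map_comp infix_refl.
exists (size p); apply: (@eq_from_nth _ s); first by rewrite size_mkseq.
move=> i lt_i; rewrite nth_mkseq //.
have := congr1 (fun w => nth s w (size p + i)) e.
rewrite /= iter_start_mkseq nth_mkseq ?e ?size_cat ?ltn_add2l ?ltn_addr //.
by rewrite !nth_cat ltnNge leq_addr addKn lt_i => ->.
Qed.

Lemma infix_iter_mono v m n : m <= n ->
  infix v (iter m phi [:: s]) -> infix v (iter n phi [:: s]).
Proof. by move=> /prefix_iter_start/prefixW h /infix_trans; apply. Qed.

(** Almost periodicity concerns length exactly [l]; a longer factor is handled through its prefix of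
    length [l]. *)
Lemma almost_periodic_letter c : almost_periodic x -> (exists i, x i = c) ->
  exists l, forall n v, infix v (iter n phi [:: s]) -> l <= size v -> c \in v.
Proof.
move=> ap [i xi]; have [|l hl] := ap [:: c].
  by exists i; rewrite /mkseq /= addn0 xi.
exists l => n v vn lv.
rewrite -infix1s; apply: infix_trans (infix_take v l).
apply: hl; last exact: size_takel.
by apply/factorP; exists n; apply: infix_trans (infix_take v l) vn.
Qed.

Lemma almost_periodic_strongly_connected :
  (forall a, exists i, x i = a) -> almost_periodic x ->
  strongly_connected_on (Iset phi) (Ggraph phi).
Proof.
move=> occ ap b c ib ic.
have [l hl] := almost_periodic_letter ap (occ c).
have [m bm] : exists m, infix [:: b] (iter m phi [:: s]).
  by apply/factorP; have [i xi] := occ b; exists i; rewrite /mkseq /= addn0 xi.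
(* Some phi^n(b) reaches length [l]; being a factor of phi^(n+m)(s), it contains [c]. *)
have /IsetP/(_ l)[//|//|n hn] := ib.
apply: (@connect_mem_iter _ _ _ _ n) => //; apply: (hl (n + m)) hn.
by rewrite iterD; apply: infix_iter.
Qed.

Lemma almost_periodic_run_bound :
  (forall a, exists i, x i = a) -> almost_periodic x ->
  exists B, forall a n, run_bound phi B (iter n phi [:: a]).
Proof.
move=> occ ap; have [l hl] := almost_periodic_letter ap (occ s).
exists l => a n v va; rewrite all_Fset leqNgt; apply: contra => /ltnW lv.
apply/hasP; exists s; last exact: Iset_start.
have [m am] : exists m, infix [:: a] (iter m phi [:: s]).
  by apply/factorP; have [i xi] := occ a; exists i; rewrite /mkseq /= addn0 xi.
apply: (hl (n + m)) lv; rewrite iterD; apply: infix_trans va _.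
exact: infix_iter.
Qed.

Lemma run_bound_almost_periodic B :
  strongly_connected_on (Iset phi) (Ggraph phi) ->
  (forall n, run_bound phi B (iter n phi [:: s])) ->
  almost_periodic x.
Proof.
move=> sc hB u /factorP[n0 un0].
have /fin_all_exists[f hf] : forall b : A, exists k, Iset phi b ->
    s \in iter k phi [:: b].
  move=> b; have [ib|_] := boolP (Iset phi b); last by exists 0.
  by have [k hk] := connect_iter_mem phiM (sc b s ib Iset_start); exists k.
(* Once [s] appears it persists under iteration, so the maximum serves all letters of I at once. *)
pose K := \max_b f b.
have sK b : Iset phi b -> s \in iter K phi [:: b].
  move=> ib; rewrite -(subnK (leq_bigmax b : f b <= K)) iterD.
  by apply/mem_iterP => //; exists s; [apply: hf | apply: start_mem_iter].
(* For [b] in I, phi^N(b) contains phi^n0(s), hence [u]. *)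
pose N := n0 + K; pose D := \max_a size (iter N phi [:: a]).
have hD a : size (iter N phi [:: a]) <= D by apply: (leq_bigmax a).
(* This length leaves room for phi^N(w) with [w] of length [B + 1], too long to be over F. *)
exists (B.+2 * D).+1 => v /factorP[m vm] szv.
have {}vm : infix v (iter N phi (iter m phi [:: s])).
  by rewrite -iterD; apply: infix_iter_mono vm; apply: leq_addl.
have [|w [wm szw wv]] := infix_iter_desubst phiM hD vm (k := B.+1).
  by rewrite szv.
have /hasP[b bw ib] : has (Iset phi) w.
  apply/negPn/negP; rewrite -all_Fset => /(hB _ _ wm).
  by rewrite szw ltnn.
apply: infix_trans wv; apply: infix_trans (infix_iter_letter phiM N bw).
rewrite /N iterD; apply: infix_trans un0 _.
exact: infix_iter_letter (sK b ib).
Qed.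

End Limit.

(** * Bounded factors over F and the two graphs *)

Lemma run_bound_cycle_labels (A : finType) (phi : seq A -> seq A) :
  {morph phi : u v / u ++ v} -> nonerasing phi ->
  (exists B, forall a n, run_bound phi B (iter n phi [:: a])) <->
  cycle_labels_empty (Lgraph phi) /\ cycle_labels_empty (Rgraph phi).
Proof.
move=> phiM ne; split=> [[B hB]|[cL cR]].
  (* The maximal prefix over F is itself a factor over F. *)
  have find_le w : run_bound phi B w -> find (Iset phi) w <= B.
    move=> rw; rewrite -(size_takel (find_size (Iset phi) w)).
    apply: rw; first exact: infix_take.
    by rewrite all_Fset has_take_leq ?ltnn // find_size.
  have rev_run w : run_bound phi B w -> run_bound phi B (rev w).
    by move=> rw v; rewrite -infix_revLR => /rw; rewrite size_rev !all_Fset has_rev.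
  split.
    by apply: (prefix_bound_cycle_labels phiM ne (P := B)) => a n _; apply: find_le.
  (* Suffixes over F become prefixes for the reversed morphism. *)
  apply/cycle_labels_rev_morph/(@prefix_bound_cycle_labels _ _ _ _ B).
  - exact: rev_morphM.
  - exact: rev_morph_nonerasing.
  rewrite Iset_rev_morph => a n _; rewrite iter_rev_morph.
  by apply/find_le/rev_run/hB.
have [P1 h1] := cycle_labels_prefix_bound phiM ne cL.
have [P2] := cycle_labels_prefix_bound (rev_morphM phiM)
  (rev_morph_nonerasing ne) ((cycle_labels_rev_morph phi).1 cR).
rewrite Iset_rev_morph => h2.
apply: (@run_bound_iter _ phi phiM ne (maxn P1 P2)) => a n ia.
  by rewrite leq_max h1.
by have := h2 a n ia; rewrite iter_rev_morph leq_max => ->; rewrite orbT.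
Qed.

Theorem theorem1 (A : finType) (phi : seq A -> seq A) (s : A)
  (phi_morph : {morph phi : u v / u ++ v})
  (phi_nonerasing : nonerasing phi)
  (phi_prolongable : prolongable phi s)
  (all_occur : forall a : A, exists i : nat, phi_infty phi s i = a) :
  almost_periodic (phi_infty phi s) <->
  strongly_connected_on (Iset phi) (Ggraph phi) /\
  (cycle_labels_empty (Lgraph phi) /\ cycle_labels_empty (Rgraph phi)).
Proof.
split=> [ap|[sc /run_bound_cycle_labels[]// B hB]].
  split.
    exact: (almost_periodic_strongly_connected phi_morph phi_nonerasing
              phi_prolongable all_occur ap).
  apply/run_bound_cycle_labels => //.
  exact: (almost_periodic_run_bound phi_morph phi_nonerasing
            phi_prolongable all_occur ap).
exact: (run_bound_almost_periodic phi_morph phi_nonerasing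
          phi_prolongable sc (hB s)).
Qed.
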